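(* Let $q$ be a prime power and let $\mathcal{A}$ be an essential central arrangement of hyperplanes in $\mathbb{F}_q^3$. For $i\ge 0$ let $n^{\mathcal{A}}_i$ be the number of points of the projective plane $\mathrm{PG}(2,q)$ (i.e. one-dimensional subspaces of $\mathbb{F}_q^3$) which lie on exactly $i$ hyperplanes of $\mathcal{A}$. Then $\mathcal{A}$ is combinatorially simplicial if and only if \[ |\mathcal{A}| = 3q-\frac{3n^{\mathcal{A}}_0+2n^{\mathcal{A}}_1}{q+1}. \]
   Context: An arrangement of hyperplanes $\mathcal{A}$ is a finite set of hyperplanes in a vector space $V=K^r$ over a field $K$. It is central if all hyperplanes are linear subspaces; a central arrangement is essential if the intersection of all its hyperplanes is $0$. The intersection lattice $L(\mathcal{A})$ is the set of all intersections of elements of $\mathcal{A}$ (including $V$ as the empty intersection), ordered by reverse inclusion. The characteristic polynomial is $\chi_{\mathcal{A}}(t)=\sum_{X\in L(\mathcal{A})}\mu(X)t^{\dim X}$, where $\mu(X)=\mu(V,X)$ is the Möbius function of $L(\mathcal{A})$. For $X\in L(\mathcal{A})$ the restriction is the arrangement $\mathcal{A}^X=\{X\cap H\mid H\in\mathcal{A},\ X\not\subseteq H,\ X\cap H\neq\emptyset\}$ in $X$. A finite set $\mathcal{A}$ of hyperplanes in $K^r$ is called (combinatorially) simplicial if it is a central, essential arrangement satisfying $r\chi_{\mathcal{A}}(-1)+2\sum_{H\in\mathcal{A}}\chi_{\mathcal{A}^H}(-1)=0$. *)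

(* Defs.v *)
From mathcomp Require Import all_boot all_order all_algebra.
From mathcomp Require Import finmap.

Set Implicit Arguments.
Unset Strict Implicit.
Unset Printing Implicit Defensive.

Import Order.TTheory GRing.Theory Num.Theory.
Local Open Scope fset_scope.
Local Open Scope ring_scope.

Section Mobius.

Variables (T : choiceType) (le : rel T) (L : {fset T}).

(* The fuel [n] only makes the recursion structural: #|` L | is enough for it
   never to run out, see [mobius_xx] and [mobius_rec]. *)
Fixpoint mobius_fuel (n : nat) (x y : T) : int :=
  if x == y then 1 else
  if n is n'.+1 then
    - \sum_(z <- L | [&& le x z, le z y & z != y]) mobius_fuel n' x z
  else 0.

(* The Möbius function of the poset (L, le). *)
Definition mobius (x y : T) : int := mobius_fuel #|` L | x y.

Lemma mobius_xx x : mobius x x = 1.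
Proof. by rewrite /mobius; case: #|` _ | => [|n] /=; rewrite eqxx. Qed.

Hypothesis le_trans : transitive le.
Hypothesis le_anti : antisymmetric le.

Let below y := [fset z in L | le z y && (z != y)].

Let below_lt y z : z \in L -> le z y -> z != y -> (#|` below z | < #|` below y |)%N.
Proof.
move=> zL zy zny; apply: fproper_ltn_card; rewrite fproperE; apply/andP; split.
  apply/fsubsetP => w; rewrite !inE => /and3P[-> wz wnz] /=.
  rewrite (le_trans wz zy) /=; apply/eqP => wy; move: zny.
  by rewrite (@le_anti z y) ?eqxx // zy -wy wz.
apply/fsubsetPn; exists z; rewrite !inE ?eqxx ?andbF //.
by rewrite zL zy zny.
Qed.

Let fuelE n m x y : (#|` below y | <= n)%N -> (#|` below y | <= m)%N ->
  mobius_fuel n x y = mobius_fuel m x y.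
Proof.
elim: n m y => [|n IHn] [|m] y //= yn ym; case: eqP => // _.
- rewrite big_seq_cond big_pred0 ?oppr0 // => z; apply/negP => /and4P[zL _ zy zny].
  by have := below_lt zL zy zny; rewrite ltnNge (leq_trans yn).
- rewrite big_seq_cond big_pred0 ?oppr0 // => z; apply/negP => /and4P[zL _ zy zny].
  by have := below_lt zL zy zny; rewrite ltnNge (leq_trans ym).
- congr (- _); rewrite big_seq_cond [RHS]big_seq_cond.
  apply: eq_bigr => z /and4P[zL _ zy zny].
  have lt := below_lt zL zy zny.
  by apply: IHn; rewrite -ltnS; apply: leq_trans lt _.
Qed.

Lemma mobius_rec x y : x != y -> y \in L ->
  mobius x y = - \sum_(z <- L | [&& le x z, le z y & z != y]) mobius x z.
Proof.
move=> xny yL.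
have cardL w : (#|` below w | <= #|` L |)%N.
  by apply/fsubset_leq_card/fsubsetP => z; rewrite !inE => /andP[].
rewrite {1}/mobius (@fuelE _ #|` L |.+1) ?(leqW (cardL y)) //=.
by rewrite (negbTE xny).
Qed.

End Mobius.

Section Arrangement.

Variables (K : fieldType) (vT : vectType K).
Implicit Types (U X : {vspace vT}) (A : {fset {vspace vT}}).

(* Only central arrangements are considered, so hyperplanes are linear
   subspaces.  The ambient space is a subspace [U] of [vT], so that [A] and its
   restrictions (arrangements in a smaller space) are treated uniformly. *)
Definition central_arrangement U A : Prop :=
  forall H, H \in A -> (H <= U)%VS /\ (\dim H).+1 = \dim U.

Definition arr_center U A : {vspace vT} := (U :&: \bigcap_(H <- A) H)%VS.

Definition essential U A : Prop := arr_center U A = 0%VS.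

Definition intersection_lattice U A : {fset {vspace vT}} :=
  [fset arr_center U B | B in fpowerset A].

Definition rev_incl : rel {vspace vT} := fun X Y => (Y <= X)%VS.

Definition char_poly_arr U A : {poly int} :=
  \sum_(X <- intersection_lattice U A)
     mobius rev_incl (intersection_lattice U A) U X *: 'X^(\dim X).

(* X :&: H is never empty, since both are linear subspaces. *)
Definition restriction A X : {fset {vspace vT}} :=
  [fset (X :&: H)%VS | H in A & ~~ (X <= H)%VS].

Definition simplicial A : Prop :=
  [/\ central_arrangement fullv A, essential fullv A &
      (\dim {:vT})%:Z * (char_poly_arr fullv A).[-1]
        + 2 * \sum_(H <- A) (char_poly_arr H (restriction A H)).[-1] = 0].

Lemma rev_incl_trans : transitive rev_incl.
Proof. by move=> Y X Z YX ZY; apply: subv_trans ZY YX. Qed.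

Lemma rev_incl_anti : antisymmetric rev_incl.
Proof. by move=> X Y; rewrite /rev_incl andbC => /subv_anti. Qed.

End Arrangement.

Section ProjectivePlane.

Variable F : finFieldType.

Definition pg2_points : {fset {vspace 'rV[F]_3}} :=
  [fset <[v]>%VS | v in [set v : 'rV[F]_3 | v != 0]].

Lemma pg2_pointsP (P : {vspace 'rV[F]_3}) : (P \in pg2_points) = (\dim P == 1%N).
Proof.
apply/imfsetP/eqP => [[v /=]|dP].
  by rewrite inE => v0 ->; rewrite dim_vline v0.
have P0 : P != 0%VS by rewrite -dimv_eq0 dP.
exists (vpick P); first by rewrite inE vpick0.
apply/esym/eqP; rewrite eqEdim -memvE memv_pick /=.
by rewrite dim_vline vpick0 P0 dP.
Qed.

Definition num_points (A : {fset {vspace 'rV[F]_3}}) (i : nat) : nat :=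
  #|` [fset P in pg2_points | #|` [fset H in A | (P <= H)%VS] | == i] |.

End ProjectivePlane.

(* Main.v *)
Require Import Defs.
From mathcomp Require Import all_boot all_order all_algebra all_field.
From mathcomp Require Import finmap.
From mathcomp Require Import ring zify.

(** Both sides of the equivalence say that
      3 + \sum_P (m P - 3) = 0,
    the sum being over the points P of the plane that lie on at least two
    lines of A, with m P ([mult A P]) the number of lines of A through P.

    Combinatorial side.  Evaluating a characteristic polynomial at -1 and
    subtracting \sum_X mu(X) = 0 kills the flats of even dimension and doubles
    those of odd dimension ([char_poly_evalN1]).  In rank 2 only the points of
    the lattice survive, each with mu = -1; in rank 3 the whole space, with
    mu = 1, and the points P, with mu = m P - 1, survive.  Hence
      chi_A(-1) = - 2 - 2 \sum_P (m P - 1)   and   chi_{A^H}(-1) = 2 |A^H|,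
    where A^H is the set of points of H on at least one further line of A
    ([mem_restriction]).  By double counting, \sum_H |A^H| is \sum_P m P, so
    that the defining expression of simpliciality is - 2 times the displayed
    left-hand side ([simplicial_excess]).

    Counting side.  Extend the sum to all q^2 + q + 1 points.  A line has q + 1
    points, so the sum of m P over the whole plane is |A| (q + 1)
    ([sum_mult]), while the added points on 0 or 1 line contribute -3 and -2
    each ([sum_excess]).  The displayed equation thus becomes
      |A| (q + 1) + 3 n_0 + 2 n_1 = 3 q (q + 1). *)

Set Implicit Arguments.
Unset Strict Implicit.

Import Order.TTheory GRing.Theory Num.Theory.
Local Open Scope fset_scope.
Local Open Scope ring_scope.

(** * Sums over finite sets *)

Lemma card_fset_filter (T : choiceType) (S : {fset T}) (p : pred T) :
  #|` [fset x in S | p x]| = (\sum_(x <- S) p x)%N.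
Proof.
rewrite card_fset_sum1 -big_fset_condE big_mkcond.
by apply: eq_bigr => x _; case: (p x).
Qed.

Lemma big_fset_D1_cond (R : Type) (idx : R) (op : Monoid.com_law idx)
    (T : choiceType) (S : {fset T}) (p : pred T) (a : T) (f : T -> R) :
  a \in S -> p a ->
  \big[op/idx]_(x <- S | p x) f x =
    op (f a) (\big[op/idx]_(x <- S | p x && (x != a)) f x).
Proof.
move=> aS pa; rewrite -big_filter (bigD1_seq a) ?filter_uniq ?fset_uniq //=.
  by rewrite big_filter_cond.
by rewrite mem_filter pa.
Qed.

Lemma ltn_dimv (K : fieldType) (vT : vectType K) (X Y : {vspace vT}) :
  (X <= Y)%VS -> X != Y -> (\dim X < \dim Y)%N.
Proof. by move=> XY; rewrite (ltn_leqif (dimv_leqif_eq XY)). Qed.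

(** * The Möbius function near the top of a family of subspaces *)

Section Mobius.
Context {K : fieldType} {vT : vectType K}.
Variables (U : {vspace vT}) (L : {fset {vspace vT}}).
Hypothesis subU : forall X, X \in L -> (X <= U)%VS.
Hypothesis UL : U \in L.

Let mu := mobius (@rev_incl K vT) L U.

Let mu_rec X : X != U -> X \in L ->
  mu X = - \sum_(Z <- L | (X <= Z)%VS && (Z != X)) mu Z.
Proof.
move=> XU XL; rewrite /mu mobius_rec //; first last.
- by rewrite eq_sym.
- exact: rev_incl_anti.
- exact: rev_incl_trans.
congr (- _); rewrite big_seq_cond [RHS]big_seq_cond; apply: eq_bigl => Z.
by rewrite /rev_incl; case: (boolP (Z \in L)) => //= /subU ->.
Qed.

(** This is the recursion that defines the Möbius function, read at the bottom
    element of the family. *)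
Lemma sum_mobius0 : 0%VS \in L -> U != 0%VS -> \sum_(X <- L) mu X = 0.
Proof.
move=> L0 U0; rewrite (bigD1_seq 0%VS) ?fset_uniq //= mu_rec // 1?eq_sym //.
rewrite (eq_bigl (fun Z => Z != 0%VS)) ?addNr // => Z; by rewrite sub0v.
Qed.

Lemma mobius_corank1 X : X \in L -> (\dim X).+1 = \dim U -> mu X = -1.
Proof.
move=> XL dX; have XU : X != U by apply/eqP => e; move: dX; rewrite e; lia.
rewrite mu_rec // -big_filter; congr (- _).
rewrite (_ : [seq _ <- _ | _] = filter (pred1 U) L); last first.
  apply: eq_in_filter => Z ZL /=; apply/andP/eqP => [[XZ ZX]|->]; last first.
    by rewrite subU // eq_sym.
  apply/eqP; rewrite eqEdim subU //= -dX.
  by rewrite ltn_dimv // eq_sym.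
rewrite filter_pred1_uniq ?fset_uniq // big_seq1; exact: mobius_xx.
Qed.

(** Strictly above a subspace of codimension 2 there are only [U], where the
    Möbius function is 1, and hyperplanes of [U], where it is -1. *)
Lemma mobius_corank2 X : X \in L -> (\dim X).+2 = \dim U ->
  mu X = (\sum_(H <- L) ((X <= H)%VS && ((\dim H).+1 == \dim U)))%N%:R - 1.
Proof.
move=> XL dX; have XU : X != U by apply/eqP => e; move: dX; rewrite e; lia.
rewrite mu_rec // big_mkcond (bigD1_seq U) ?fset_uniq //=.
rewrite subU // eq_sym XU /= (mobius_xx _ _ U : mu U = 1).
rewrite opprD addrC; congr (_ - 1); rewrite natr_sum -sumrN big_mkcond /=.
rewrite big_seq [RHS]big_seq; apply: eq_bigr => Z ZL.
case: (boolP (X <= Z)%VS) => XZ /=; last by rewrite oppr0 if_same.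
have [->|ZX] := eqVneq Z X.
  by rewrite /= oppr0 if_same -dX eqn_leq ltnn andbF.
have [->|ZU] := eqVneq Z U; first by rewrite /= eqn_leq ltnn.
have dZ : (\dim Z).+1 = \dim U.
  have ltXZ : (\dim X < \dim Z)%N by rewrite ltn_dimv // eq_sym.
  have ltZU : (\dim Z < \dim U)%N by rewrite ltn_dimv // subU.
  by lia.
by rewrite /= dZ eqxx mobius_corank1 // opprK.
Qed.

End Mobius.

(** * Intersection lattices and restrictions of central arrangements *)

Section Arrangement.
Context {K : fieldType} {vT : vectType K}.
Implicit Types (U X H : {vspace vT}) (A B : {fset {vspace vT}}).

Lemma sub_arr_center U A X :
  (X <= arr_center U A)%VS = (X <= U)%VS && all (fun H => (X <= H)%VS) A.
Proof.
rewrite /arr_center subv_cap; congr (_ && _).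
by elim: (enum_fset A) => [|H s IH]; rewrite ?big_nil ?subvf // big_cons subv_cap IH.
Qed.

Lemma sub_arr_centerP U A X :
  reflect ((X <= U)%VS /\ forall H, H \in A -> (X <= H)%VS) (X <= arr_center U A)%VS.
Proof. by rewrite sub_arr_center; apply: (iffP andP) => -[h /allP]. Qed.

Lemma latticeP U A X :
  reflect (exists2 B, B `<=` A & X = arr_center U B) (X \in intersection_lattice U A).
Proof.
apply: (iffP (imfsetP _ _ _ _)) => -[B /= hB ->]; exists B => //.
  by move: hB; rewrite fpowersetE.
by rewrite fpowersetE.
Qed.

Lemma lattice_sub U A X : X \in intersection_lattice U A -> (X <= U)%VS.
Proof. by case/latticeP => B _ ->; exact: capvSl. Qed.

Lemma mem_lattice_top U A : U \in intersection_lattice U A.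
Proof.
apply/latticeP; exists fset0; first exact: fsub0set.
by rewrite /arr_center big_seq_fset0 capvf.
Qed.

Lemma mem_lattice_center U A : arr_center U A \in intersection_lattice U A.
Proof. by apply/latticeP; exists A. Qed.

(** A flat of codimension 1 is contained in, hence equal to, any hyperplane of
    the subfamily of which it is the intersection. *)
Lemma lattice_hyperplane U A X : central_arrangement U A ->
  (X \in intersection_lattice U A) && ((\dim X).+1 == \dim U) = (X \in A).
Proof.
move=> hA; apply/andP/idP => [[/latticeP[B BA eX] /eqP dX]|XA].
  have [B0|[H HB]] := fset_0Vmem B.
    by move: dX; rewrite eX B0 /arr_center big_seq_fset0 capvf; lia.
  have HA := fsubsetP BA _ HB; have [_ dH] := hA _ HA.
  have XH : (X <= H)%VS by have := subvv X; rewrite {2}eX => /sub_arr_centerP[_ ->].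
  suff -> : X = H by [].
  by apply/eqP; rewrite eqEdim XH; lia.
have [XU dX] := hA _ XA; rewrite dX eqxx; split=> //.
apply/latticeP; exists [fset X]; first by rewrite fsub1set.
by rewrite /arr_center big_seq_fset1; apply/esym/capv_idPr.
Qed.

Definition mult A X : nat := #|` [fset H in A | (X <= H)%VS]|.

Lemma dim_cap_hyperplanes U H H' : (H <= U)%VS -> (H' <= U)%VS ->
  (\dim H).+1 = \dim U -> (\dim H').+1 = \dim U -> H != H' ->
  (\dim (H :&: H')).+2 = \dim U.
Proof.
move=> HU HU' dH dH' ne.
have := dimv_sum_cap H H'.
have sU : (H + H' <= U)%VS by rewrite subv_add HU.
have := dimvS sU; have := dimvS (addvSl H H').
(* H + H' lies between H and U, so its dimension is that of U unless H' <= H. *)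
suff : \dim (H + H') <> \dim H by lia.
move=> e; case/eqP: ne; apply/esym/eqP; rewrite eqEdim; apply/andP; split; last by lia.
have /eqP -> : (H == H + H')%VS by rewrite eqEdim addvSl e leqnn.
exact: addvSr.
Qed.

Lemma mult_ge2P A X :
  reflect (exists H H', [/\ H \in A, H' \in A, H != H', (X <= H)%VS & (X <= H')%VS])
          (2 <= mult A X)%N.
Proof.
rewrite /mult; set B := [fset _ in _ | _].
apply: (iffP idP) => [B2|[H [H' [HA HA' ne XH XH']]]].
  have [H HB] : exists H, H \in B by apply/fset0Pn; rewrite -cardfs_gt0; lia.
  have [H' HB'] : exists H', H' \in B `\ H.
    by apply/fset0Pn; rewrite -cardfs_gt0; move: B2; rewrite (cardfsD1 H) HB.
  move: HB HB'; rewrite !inE /= => /andP[HA XH] /and3P[ne HA' XH'].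
  by exists H, H'; rewrite eq_sym.
have <- : #|` [fset H; H']| = 2%N by rewrite cardfs2 ne.
by apply: fsubset_leq_card; rewrite fsubUset !fsub1set !inE /= HA HA' XH.
Qed.

(** The intersection of fewer than two hyperplanes has codimension at most 1,
    and that of any two distinct ones already has codimension 2. *)
Lemma lattice_corank2 U A X : central_arrangement U A -> (X <= U)%VS ->
  (\dim X).+2 = \dim U -> (X \in intersection_lattice U A) = (2 <= mult A X)%N.
Proof.
move=> hA XU dX; apply/latticeP/mult_ge2P => [[B BA eX]|[H [H' [HA HA' ne XH XH']]]].
  have XB H : H \in B -> (X <= H)%VS.
    by move=> HB; have := subvv X; rewrite {2}eX => /sub_arr_centerP[_ ->].
  have [B0|[H HB]] := fset_0Vmem B.
    by move: dX; rewrite eX B0 /arr_center big_seq_fset0 capvf; lia.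
  have [B0|[H' HB']] := fset_0Vmem (B `\ H).
    have BE : B = [fset H] by rewrite -(fsetD1K HB) B0 fsetU0.
    have [HU dH] := hA _ (fsubsetP BA _ HB).
    by move: dX; rewrite eX BE /arr_center big_seq_fset1 (capv_idPr HU); lia.
  move: HB'; rewrite !inE => /andP[ne HB'].
  by exists H, H'; rewrite !(fsubsetP BA) // !XB // eq_sym.
have [HU dH] := hA _ HA; have [HU' dH'] := hA _ HA'.
exists [fset H; H']; first by rewrite fsubUset !fsub1set HA.
apply/eqP; rewrite eqEdim; apply/andP; split.
  by apply/sub_arr_centerP; split => // Z; rewrite !inE => /orP[] /eqP ->.
have /dimvS : (arr_center U [fset H; H'] <= H :&: H')%VS.
  have /sub_arr_centerP[_ h] := subvv (arr_center U [fset H; H']).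
  by rewrite subv_cap !h // !inE eqxx ?orbT.
have := dim_cap_hyperplanes HU HU' dH dH' ne; lia.
Qed.

(** Subtracting the vanishing sum of all Möbius values replaces the weight
    (-1)^(dim X) by (-1)^(dim X) - 1, which is 0 or -2. *)
Lemma char_poly_evalN1 U A : essential U A -> U != 0%VS ->
  (char_poly_arr U A).[-1] = - 2 *
    \sum_(X <- intersection_lattice U A | odd (\dim X))
      mobius (@rev_incl K vT) (intersection_lattice U A) U X.
Proof.
move=> ess U0; rewrite /char_poly_arr; set L := intersection_lattice U A.
have s0 : \sum_(X <- L) mobius (@rev_incl K vT) L U X = 0.
  by apply: sum_mobius0 => //; [exact: lattice_sub | rewrite -ess mem_lattice_center].
rewrite horner_sum -[LHS]subr0 -{2}s0 -sumrB mulr_sumr [RHS]big_mkcond /=.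
apply: eq_bigr => X _; rewrite hornerZ hornerXn -signr_odd.
by case: (odd _); rewrite ?expr1 ?expr0; ring.
Qed.

Lemma char_poly_rank2 U A : central_arrangement U A -> essential U A ->
  \dim U = 2%N -> (char_poly_arr U A).[-1] = 2 * #|` A|%:R.
Proof.
move=> hA ess dU; rewrite char_poly_evalN1 //; last by rewrite -dimv_eq0 dU.
set L := intersection_lattice U A.
have -> : A = [fset X in L | (\dim X).+1 == \dim U].
  by apply/fsetP => X; rewrite inE /= -(lattice_hyperplane _ hA).
rewrite card_fset_filter natr_sum !mulr_sumr big_mkcond /= big_seq [RHS]big_seq.
apply: eq_bigr => X XL.
have XU := lattice_sub XL; have := dimvS XU; rewrite dU eqSS.
case E : (\dim X) => [|[|[|d]]] //= _; rewrite ?mulr0 //.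
have -> : mobius (@rev_incl K vT) L U X = -1.
  by apply: mobius_corank1; rewrite ?E ?dU ?mem_lattice_top // => Y /lattice_sub.
by rewrite mulrNN mulr1.
Qed.

(** The flats of odd dimension are [U] itself and the points. *)
Lemma char_poly_rank3 U A : central_arrangement U A -> essential U A ->
  \dim U = 3%N -> (char_poly_arr U A).[-1] =
  - 2 * (1 + \sum_(X <- intersection_lattice U A | \dim X == 1%N)
               ((mult A X)%:R - 1)).
Proof.
move=> hA ess dU; rewrite char_poly_evalN1 //; last by rewrite -dimv_eq0 dU.
set L := intersection_lattice U A; congr (_ * _).
have UL : U \in L := mem_lattice_top U A.
have subU X : X \in L -> (X <= U)%VS by exact: lattice_sub.
rewrite (big_fset_D1_cond _ _ UL) ?dU //=.
rewrite (mobius_xx _ _ U); congr (1 + _).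
rewrite big_seq_cond [RHS]big_seq_cond; apply: eq_big => [X|X /and3P[XL oX XU]].
  case: (boolP (X \in L)) => XL //=; have := dimvS (subU _ XL); rewrite dU.
  case E : (\dim X) => [|[|[|[|d]]]] //= _; last first.
    by apply/negbF/eqP; apply/eqP; rewrite eqEdim subU // E dU.
  by apply/eqP => XU; move: E; rewrite XU dU.
have dX : \dim X = 1%N.
  have := dimvS (subU _ XL); rewrite dU; move: oX.
  case E : (\dim X) => [|[|[|[|d]]]] //= _ _.
  by case/eqP: XU; apply/eqP; rewrite eqEdim subU // E dU.
rewrite mobius_corank2 ?dX ?dU //; congr (_%:R - 1).
have AE : A = [fset H in L | (\dim H).+1 == \dim U].
  by apply/fsetP => H; rewrite inE /= -(lattice_hyperplane _ hA).
rewrite /mult card_fset_filter AE -big_fset_condE /=.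
rewrite [RHS]big_mkcond dU.
by apply: eq_bigr => H _ /=; rewrite andbC; case: eqP.
Qed.

Lemma restriction_central U A H : central_arrangement U A -> H \in A ->
  central_arrangement H (restriction A H).
Proof.
move=> hA HA X /imfsetP[H' /= /andP[HA' nHH'] ->].
have [HU dH] := hA _ HA; have [HU' dH'] := hA _ HA'.
split; first exact: capvSl.
have ne : H != H' by apply: contraNneq nHH' => ->.
have := dim_cap_hyperplanes HU HU' dH dH' ne; lia.
Qed.

Lemma arr_center_restriction U A H : central_arrangement U A -> H \in A ->
  arr_center H (restriction A H) = arr_center U A.
Proof.
move=> hA HA; have [HU _] := hA _ HA.
apply/eqP; rewrite eqEsubv; apply/andP; split; apply/sub_arr_centerP.
  have /sub_arr_centerP[cH cR] := subvv (arr_center H (restriction A H)).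
  split=> [|H' HA']; first exact: subv_trans cH HU.
  have [HH'|nHH'] := boolP (H <= H')%VS; first exact: subv_trans cH HH'.
  apply: subv_trans (capvSr H H'); apply: cR; apply/imfsetP; exists H' => //=.
  by rewrite inE HA'.
have /sub_arr_centerP[cU cA] := subvv (arr_center U A).
split=> [|X /imfsetP[H' /= /andP[HA' _] ->]]; first exact: cA.
by rewrite subv_cap !cA.
Qed.

(** If two members of [A] contain [X], one of them differs from [H] and so
    cuts [H] exactly in [X]. *)
Lemma mem_restriction U A H X : central_arrangement U A -> H \in A ->
  (\dim X).+2 = \dim U ->
  (X \in restriction A H) = (X <= H)%VS && (2 <= mult A X)%N.
Proof.
move=> hA HA dX; have [HU dH] := hA _ HA.
apply/imfsetP/andP => [[H' /= /andP[HA' nHH'] ->]|[XH /mult_ge2P]].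
  split; first exact: capvSl.
  apply/mult_ge2P; exists H, H'; rewrite capvSl capvSr; split=> //.
  by apply: contraNneq nHH' => ->.
case=> H1 [H2 [HA1 HA2 ne XH1 XH2]].
have [H' [HA' ne' XH']] : exists H', [/\ H' \in A, H != H' & (X <= H')%VS].
  by have [e|n] := eqVneq H H1; [exists H2; rewrite e | exists H1].
have [HU' dH'] := hA _ HA'.
exists H'; rewrite ?inE /= ?HA' /=.
  apply/negP => HH'; case/eqP: ne'; apply/eqP; rewrite eqEdim HH'; lia.
apply/eqP; rewrite eqEdim subv_cap XH XH' /=.
have := dim_cap_hyperplanes HU HU' dH dH' ne'; lia.
Qed.

End Arrangement.

(** * Counting in the projective plane *)

Section ProjectivePlane.
Variable F : finFieldType.
Notation V := 'rV[F]_3.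
Implicit Types (U P : {vspace V}) (A : {fset {vspace V}}).

Lemma sum_nonzero_vectors U :
  (\sum_(v : V | (v != 0%R) && (v \in U)) 1 = (#|F| ^ \dim U).-1)%N.
Proof.
rewrite -(@card_vspace F V _ U) (cardD1 0 (mem U)) mem0v sum1dep_card.
by apply: eq_card => v; rewrite !inE.
Qed.

(** Every nonzero vector of [U] spans exactly one point of [U], and every point
    is spanned by q - 1 vectors. *)
Lemma sum_points_sub U :
  (\sum_(P <- pg2_points F | (P <= U)%VS) #|F|.-1 = (#|F| ^ \dim U).-1)%N.
Proof.
transitivity (\sum_(P <- pg2_points F | (P <= U)%VS)
   \sum_(v : V | (v != 0%R) && (v \in P)) 1)%N.
  rewrite big_seq_cond [RHS]big_seq_cond; apply: eq_bigr => P /andP[].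
  by rewrite pg2_pointsP => /eqP dP _; rewrite sum_nonzero_vectors dP expn1.
rewrite (exchange_big_dep (fun v : V => (v != 0%R) && (v \in U))) /=; last first.
  by move=> P v PU /andP[-> vP]; rewrite (subvP PU).
rewrite -sum_nonzero_vectors; apply: eq_bigr => v /andP[v0 vU].
have vP : <[v]>%VS \in pg2_points F by rewrite pg2_pointsP dim_vline v0.
rewrite (big_fset_D1_cond _ _ vP) /=; last by rewrite -memvE vU v0 memv_line.
rewrite big_seq_cond big_pred0 // => P; apply/negP => /and3P[].
rewrite pg2_pointsP => /eqP dP /and3P[_ _ vinP] /eqP[].
by apply/eqP; rewrite eq_sym eqEdim -memvE vinP dP dim_vline v0.
Qed.

Lemma card_points_sub U :
  (#|` [fset P in pg2_points F | (P <= U)%VS]| * #|F|.-1 = (#|F| ^ \dim U).-1)%N.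
Proof.
rewrite -sum_points_sub card_fset_filter big_distrl [RHS]big_mkcond /=.
by apply: eq_bigr => P _; case: (P <= U)%VS; rewrite ?mul1n.
Qed.

Lemma card_points : (#|` pg2_points F| = #|F| ^ 2 + #|F| + 1)%N.
Proof.
have q1 : (1 < #|F|)%N := finNzRing_gt1 F; have := card_points_sub fullv.
have -> : [fset P in pg2_points F | (P <= fullv)%VS] = pg2_points F.
  by apply/fsetP => P; rewrite !inE /= subvf andbT.
rewrite dimvf /dim /= => e; apply/eqP; rewrite -(@eqn_pmul2r #|F|.-1); last by lia.
by rewrite e mul1n; case: #|F| q1 => // r _; rewrite !expnS expn0 /=; nia.
Qed.

Lemma card_points_line U : \dim U = 2%N ->
  #|` [fset P in pg2_points F | (P <= U)%VS]| = #|F|.+1.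
Proof.
have q1 : (1 < #|F|)%N := finNzRing_gt1 F.
move=> dU; have := card_points_sub U; rewrite dU => e.
apply/eqP; rewrite -(@eqn_pmul2r #|F|.-1); last by lia.
by rewrite e; case: #|F| q1 => // r _; rewrite !expnS expn0 /=; nia.
Qed.

Lemma num_pointsE A i :
  num_points A i = (\sum_(P <- pg2_points F) (mult A P == i))%N.
Proof. by rewrite -card_fset_filter. Qed.

(** Double counting of incidences between points and lines of [A]. *)
Lemma sum_mult A : central_arrangement fullv A ->
  (\sum_(P <- pg2_points F) mult A P = #|` A| * #|F|.+1)%N.
Proof.
move=> hA.
under eq_bigr do rewrite /mult card_fset_filter.
rewrite exchange_big /= -sum1_size big_distrl /= big_seq [RHS]big_seq.
apply: eq_bigr => H HA; rewrite -card_fset_filter mul1n card_points_line //.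
by have [_] := hA _ HA; rewrite dimvf /dim /= => -[].
Qed.

(** The summand m - 3 equals -3 and -2 on the points with m = 0 and m = 1,
    which accounts for the two correction terms. *)
Lemma sum_excess A : central_arrangement fullv A ->
  \sum_(P <- pg2_points F | (2 <= mult A P)%N) ((mult A P)%:R - 3) =
  #|` A|%:R * (#|F|%:R + 1) - 3 * (#|F|%:R ^+ 2 + #|F|%:R + 1)
  + 3 * (num_points A 0)%:R + 2 * (num_points A 1)%:R :> int.
Proof.
move=> hA.
have -> : #|` A|%:R * (#|F|%:R + 1) = \sum_(P <- pg2_points F) (mult A P)%:R :> int.
  by rewrite -natr_sum sum_mult // natrM -natr1.
have -> : #|F|%:R ^+ 2 + #|F|%:R + 1 = \sum_(P <- pg2_points F) 1%:R :> int.
  by rewrite -natr_sum -card_fset_sum1 card_points !natrD natrX.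
rewrite !num_pointsE !natr_sum !mulr_sumr -sumrB -!big_split big_mkcond /=.
by apply: eq_bigr => P _; case: (mult A P) => [|[|m]] //=; ring.
Qed.

(** * Simplicial arrangements in the plane *)

Lemma char_poly_PG2 A : central_arrangement fullv A -> essential fullv A ->
  (char_poly_arr fullv A).[-1] =
  - 2 * (1 + \sum_(P <- pg2_points F | (2 <= mult A P)%N) ((mult A P)%:R - 1)).
Proof.
move=> hA ess; have d3 : \dim (fullv : {vspace V}) = 3%N by rewrite dimvf.
rewrite char_poly_rank3 //; congr (_ * (1 + _)).
rewrite big_fset_condE [RHS]big_fset_condE; congr (\sum_(X <- enum_fset _) _).
apply/fsetP => X; rewrite !inE /= pg2_pointsP andbC.
by case: eqP => //= dX; rewrite (lattice_corank2 hA) ?subvf ?d3 ?dX.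
Qed.

Lemma char_poly_restriction_PG2 A H :
  central_arrangement fullv A -> essential fullv A -> H \in A ->
  (char_poly_arr H (restriction A H)).[-1] =
  2 * (\sum_(P <- pg2_points F | (2 <= mult A P)%N) (P <= H)%VS)%N%:R.
Proof.
move=> hA ess HA; have d3 : \dim (fullv : {vspace V}) = 3%N by rewrite dimvf.
have [_ dH] := hA _ HA; have cR := restriction_central hA HA.
rewrite char_poly_rank2 //; first last.
- by move: dH; rewrite d3 => -[].
- by rewrite /essential (arr_center_restriction hA).
congr (_ * _%:R); rewrite big_mkcond /=.
have -> : restriction A H =
    [fset P in pg2_points F | (P <= H)%VS && (2 <= mult A P)%N].
  apply/fsetP => X; rewrite !inE /= pg2_pointsP.
  have [dX|dX] := eqVneq (\dim X) 1%N; first by rewrite (mem_restriction hA) ?dX ?d3.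
  apply: contraNF dX => XR; have [_] := cR _ XR; lia.
rewrite card_fset_filter; apply: eq_bigr => P _.
by rewrite andbC; case: (2 <= _)%N.
Qed.

(** Double counting of the pairs of a line H of [A] and a point of the
    restriction to H turns the sum of the |A^H| into a sum of multiplicities;
    then 3 (- 2 - 2 \sum (m - 1)) + 4 \sum m = - 2 (3 + \sum (m - 3)). *)
Lemma simplicial_excess A : central_arrangement fullv A -> essential fullv A ->
  simplicial A <->
  3 + \sum_(P <- pg2_points F | (2 <= mult A P)%N) ((mult A P)%:R - 3) = 0 :> int.
Proof.
move=> hA ess.
have sR : \sum_(H <- A) (char_poly_arr H (restriction A H)).[-1] =
    2 * \sum_(P <- pg2_points F | (2 <= mult A P)%N) (mult A P)%:R.
  rewrite -natr_sum.
  under [in RHS]eq_bigr do rewrite /mult card_fset_filter.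
  rewrite exchange_big natr_sum mulr_sumr big_seq [RHS]big_seq.
  by apply: eq_bigr => H HA; rewrite char_poly_restriction_PG2.
have d3 : \dim {:V} = 3%N by rewrite dimvf.
have E : (\dim {:V})%:Z * (char_poly_arr fullv A).[-1]
     + 2 * \sum_(H <- A) (char_poly_arr H (restriction A H)).[-1] =
   - 2 * (3 + \sum_(P <- pg2_points F | (2 <= mult A P)%N) ((mult A P)%:R - 3)).
  rewrite d3 char_poly_PG2 // sR !big_split /= !sumrN.
  set a := \sum_(_ <- _ | _) _; set b := \sum_(_ <- _ | _) 1.
  set c := \sum_(_ <- _ | _) 3.
  have -> : c = 3 * b by rewrite mulr_sumr; apply: eq_bigr => P _; rewrite mulr1.
  ring.
split=> [[_ _]|e]; last by split=> //; rewrite E e mulr0.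
by rewrite E => /eqP; rewrite mulf_eq0 /= => /eqP.
Qed.

End ProjectivePlane.

(** * The theorem *)

Unset Implicit Arguments.
Set Strict Implicit.

Theorem theorem1p1 (q : nat) (F : finFieldType) (hq : #|F| = q)
    (A : {fset {vspace 'rV[F]_3}})
    (hA : central_arrangement fullv A) (hess : essential fullv A) :
  simplicial A <->
  (#|` A |%:R : rat) =
    3%:R * q%:R - (3 * num_points A 0 + 2 * num_points A 1)%N%:R / (q + 1)%N%:R.
Proof.
(* Cleared of its denominator, the equation is one between natural numbers. *)
set m := (3 * _ + 2 * _)%N.
apply: (@iff_trans _ ((#|` A| * (q + 1) + m)%N = (3 * q * (q + 1))%N)).
  rewrite simplicial_excess // sum_excess // hq /m; split=> e; nia.
have q1 : (q + 1)%N%:R != 0 :> rat by rewrite pnatr_eq0 addn1.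
rewrite (rwP eqP) -(eqr_nat rat) natrD !natrM -(rwP eqP).
split=> [e|->]; last by rewrite mulrBl divfK // subrK.
by apply: (mulIf q1); rewrite mulrBl divfK // -e addrK.
Qed.
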